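(* Let $A \in \mathbb{R}^{3 \times 3}$ be an $\mathbf{E_{0_2}}$-matrix. Then $\det A < 0$, and hence $A^{-1}$ exists and is a $\mathbf{Z}$-matrix. Moreover, $A$ has exactly one negative eigenvalue.
   Context: All matrices are real. A matrix $M \in \mathbb{R}^{m\times m}$ is semimonotone if for every $0 \neq x \geq 0$ (entrywise) there is an index $i$ with $x_i > 0$ and $(Mx)_i \geq 0$. A matrix $A \in \mathbb{R}^{n\times n}$ is an $\mathbf{E_{0_2}}$-matrix (semimonotone of exact order $2$) if every principal submatrix of $A$ of order $n-2$ is semimonotone, but no principal submatrix of $A$ of order $n-1$ or $n$ is semimonotone. (For $n=3$: all $1\times 1$ principal submatrices are semimonotone and no principal submatrix of order $2$ or $3$ is.) A $\mathbf{Z}$-matrix is a real square matrix whose off-diagonal entries are all nonpositive. *)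

(* Defs.v *)
From mathcomp Require Import all_boot all_order all_algebra.
From mathcomp Require Import reals.

Set Implicit Arguments.
Unset Strict Implicit.
Unset Printing Implicit Defensive.

Import Order.TTheory GRing.Theory Num.Theory.
Local Open Scope ring_scope.

Definition semimonotone (R : realType) (m : nat) (M : 'M[R]_m) : Prop :=
  forall x : 'cV[R]_m, x != 0 -> (forall i, 0 <= x i 0) ->
  exists i, 0 < x i 0 /\ 0 <= (M *m x) i 0.

Definition principal_submx (R : realType) (n : nat) (A : 'M[R]_n)
    (alpha : {set 'I_n}) : 'M[R]_#|alpha| :=
  mxsub (@enum_val _ (mem alpha)) (@enum_val _ (mem alpha)) A.

(* Orders n - 2 and n - 1 are expressed additively to avoid truncated
   subtraction. *)
Definition E0_2_matrix (R : realType) (n : nat) (A : 'M[R]_n) : Prop :=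
  (forall alpha : {set 'I_n}, (#|alpha| + 2)%N = n ->
     semimonotone (principal_submx A alpha)) /\
  (forall alpha : {set 'I_n}, (#|alpha| + 1)%N = n \/ #|alpha| = n ->
     ~ semimonotone (principal_submx A alpha)).

Definition Z_matrix (R : realType) (n : nat) (M : 'M[R]_n) : Prop :=
  forall i j : 'I_n, i != j -> M i j <= 0.

(* Eigenvalues are counted with algebraic multiplicity, so the only negative
   one is required to be a simple root of the characteristic polynomial. *)
Definition exactly_one_negative_eigenvalue (R : realType) (n : nat)
    (A : 'M[R]_n) : Prop :=
  exists lambda : R,
    [/\ lambda < 0,
        eigenvalue A lambda,
        mup lambda (char_poly A) = 1%N
      & forall mu : R, mu < 0 -> eigenvalue A mu -> mu = lambda].

(* Main.v *)
(** A principal submatrix of order 2 with nonnegative diagonal fails to be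
    semimonotone only if some positive vector has a negative image, which forces
    both off-diagonal entries and the determinant to be negative. So the diagonal
    of [A] is nonnegative, its off-diagonal entries are negative and its
    principal minors of order 2 are negative. Expanding along a row gives
    [\det A < 0], and every off-diagonal cofactor is a product of two negative
    entries minus a diagonal times a negative one, hence nonnegative. Finally
    [- char_poly A] at [- s] is [s^3 + tr A s^2 + E2 s + det A], where [E2] (the
    sum of the principal minors of order 2) and [det A] are negative: there is
    exactly one sign change, so exactly one positive root, and it is simple. *)

Require Import Defs.
From mathcomp Require Import all_boot all_order all_algebra.
From mathcomp Require Import reals.
From mathcomp Require Import ring lra.

Import Order.TTheory GRing.Theory Num.Theory.
Local Open Scope ring_scope.

(** Restating the property with functions on all of ['I_n] keeps the indices of [A] and confines the
    reindexing by [enum_val] to this proof. *)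
Lemma semimonotone_principalP (R : realType) (n : nat) (A : 'M[R]_n)
    (alpha : {set 'I_n}) :
  semimonotone (principal_submx A alpha) <->
  (forall v : 'I_n -> R, (forall i, 0 <= v i) ->
     (exists2 i, i \in alpha & v i != 0) ->
     exists i, [/\ i \in alpha, 0 < v i & 0 <= \sum_(j in alpha) A i j * v j]).
Proof.
split=> [sA v v0 [i ia vi]|sA x xn0 x0].
  have [|k|k] := sA (\col_k v (enum_val k)).
  - apply: contraNneq vi => /matrixP/(_ (enum_rank_in ia i) 0).
    by rewrite !mxE enum_rankK_in // => ->.
  - by rewrite mxE.
  - rewrite !mxE => -[vk Ak]; exists (enum_val k); split=> //.
      exact: enum_valP.
    rewrite big_enum_val; apply: le_trans Ak _.
    by apply: ler_sum => j _; rewrite !mxE.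
(* Extension of [x] by zero outside [alpha]: the sum has at most one term, as [enum_val] is
   injective. *)
pose v k := \sum_(a | enum_val a == k) x a 0.
have vE a : v (enum_val a) = x a 0.
  by rewrite /v (big_pred1 a) // => b; apply/eqP/eqP=> [/enum_val_inj|->].
have [||k [ka vk Ak]] := sA v.
- by move=> i; apply: sumr_ge0.
- have [a xa] : exists a, x a 0 != 0.
    apply/existsP; apply: contraNT xn0 => /existsPn xE.
    by apply/eqP/colP=> a; rewrite mxE; apply/eqP; rewrite -[_ == _]negbK xE.
  by exists (enum_val a); [exact: enum_valP | rewrite vE].
exists (enum_rank_in ka k); rewrite -vE enum_rankK_in //; split=> //.
rewrite !mxE; apply: le_trans Ak _; rewrite big_enum_val.
by apply: ler_sum => j _; rewrite !mxE vE enum_rankK_in.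
Qed.

Lemma semimonotone_principal1 (R : realType) (n : nat) (A : 'M[R]_n) i :
  semimonotone (principal_submx A [set i]) -> 0 <= A i i.
Proof.
move/semimonotone_principalP/(_ (fun=> 1)) => -[]//.
  by exists i; rewrite ?set11 ?oner_neq0.
by move=> k []; rewrite inE => /eqP-> _; rewrite big_set1 mulr1.
Qed.

(** From [0 <= a * x < - (b * y)] and [0 <= d * y < - (c * x)] come the signs of [b] and [c];
    multiplying the two and cancelling [x * y] compares the products. *)
Lemma mx22_negative_image (R : realFieldType) (a b c d x y : R) :
  0 <= a -> 0 <= d -> 0 < x -> 0 < y ->
  a * x + b * y < 0 -> c * x + d * y < 0 ->
  [/\ b < 0, c < 0 & a * d < b * c].
Proof.
move=> a0 d0 x0 y0 ab cd.
have ax : 0 <= a * x by apply: mulr_ge0 => //; apply: ltW.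
have dy : 0 <= d * y by apply: mulr_ge0 => //; apply: ltW.
split.
- by rewrite -(pmulr_llt0 _ y0); lra.
- by rewrite -(pmulr_llt0 _ x0); lra.
have : (a * x) * (d * y) < (- (b * y)) * (- (c * x)) by apply: ltr_pM; lra.
have -> : a * x * (d * y) = a * d * (x * y) by ring.
have -> : - (b * y) * - (c * x) = b * c * (x * y) by ring.
by rewrite ltr_pM2r // mulr_gt0.
Qed.

(** By contraposition: if [v] vanishes at [i] or [j], the nonnegative diagonal makes the other index
    a witness; otherwise [v] is positive at both and the previous lemma applies. *)
Lemma not_semimonotone_principal2 (R : realType) (n : nat) (A : 'M[R]_n) i j :
  i != j -> 0 <= A i i -> 0 <= A j j ->
  ~ semimonotone (principal_submx A [set i; j]) ->
  [/\ A i j < 0, A j i < 0 & A i i * A j j < A i j * A j i].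
Proof.
move=> ij ai aj nA; apply/and3P; apply: contraT => nC; case: nA.
apply/semimonotone_principalP => v v0 [k kij vk].
have sumE l : \sum_(m in [set i; j]) A l m * v m = A l i * v i + A l j * v j.
  by rewrite big_setU1 ?inE // big_set1.
have [vi|vi] := eqVneq (v i) 0.
  have vj : v j != 0 by case/set2P: kij vk => ->; rewrite ?vi ?eqxx.
  exists j; rewrite !inE eqxx orbT lt0r vj v0 sumE vi mulr0 add0r.
  by split=> //; apply: mulr_ge0.
have [vj|vj] := eqVneq (v j) 0.
  exists i; rewrite !inE eqxx lt0r vi v0 sumE vj mulr0 addr0.
  by split=> //; apply: mulr_ge0.
have {}vi : 0 < v i by rewrite lt0r vi v0.
have {}vj : 0 < v j by rewrite lt0r vj v0.
have [Ai|Ai] := leP 0 (A i i * v i + A i j * v j).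
  by exists i; rewrite !inE eqxx sumE.
have [Aj|Aj] := leP 0 (A j i * v i + A j j * v j).
  by exists j; rewrite !inE eqxx orbT sumE.
by case/and3P: nC; apply: mx22_negative_image Ai Aj.
Qed.

(* Natural-number indices let the ordinals created by minors compute. *)
Lemma mx33_fun (R : nmodType) (A : 'M[R]_3) :
  exists f : nat -> nat -> R, A = \matrix_(i < 3, j < 3) f i j.
Proof.
exists (fun i j => A (inord i) (inord j)).
by apply/matrixP=> i j; rewrite mxE !inord_val.
Qed.

Lemma det_mx22 (R : comNzRingType) (M : 'M[R]_2) :
  \det M = M 0 0 * M 1 1 - M 0 1 * M 1 0.
Proof.
rewrite (expand_det_row _ 0) !big_ord_recl big_ord0 /cofactor !det_mx11 !mxE /=.
have -> : lift 0 0 = 1 :> 'I_2 by apply/val_inj.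
have -> : lift 1 0 = 0 :> 'I_2 by apply/val_inj.
by rewrite /bump /=; ring.
Qed.

Lemma det_mx33 (R : comNzRingType) (f : nat -> nat -> R) :
  \det (\matrix_(i < 3, j < 3) f i j) =
    f 0 0 * (f 1 1 * f 2 2 - f 1 2 * f 2 1)
  - f 0 1 * (f 1 0 * f 2 2 - f 1 2 * f 2 0)
  + f 0 2 * (f 1 0 * f 2 1 - f 1 1 * f 2 0).
Proof.
rewrite (expand_det_row _ 0) !big_ord_recl big_ord0 /cofactor !det_mx22 !mxE.
by rewrite /= /bump /=; ring.
Qed.

Lemma char_poly_mx33 (R : comNzRingType) (f : nat -> nat -> R) :
  let A := \matrix_(i < 3, j < 3) f i j in
  char_poly A = 'X^3 - (f 0 0 + f 1 1 + f 2 2) *: 'X^2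
    - (f 0 1 * f 1 0 - f 0 0 * f 1 1 + (f 0 2 * f 2 0 - f 0 0 * f 2 2)
       + (f 1 2 * f 2 1 - f 1 1 * f 2 2)) *: 'X
    + (- \det A)%:P.
Proof.
move=> A.
have -> : char_poly A = \det (\matrix_(i < 3, j < 3)
    ('X *+ (i == j :> nat) - (f i j)%:P)).
  by congr (\det _); apply/matrixP=> i j; rewrite !mxE.
(* The same expansion serves twice: over polynomials for the left side, over [R] for the constant
   term. *)
rewrite (det_mx33 _ (fun i j => 'X *+ (i == j) - (f i j)%:P)) det_mx33 /=.
by rewrite -!mul_polyC; ring.
Qed.

(** Writing [p] as [q * ('X - x%:P)], the derivative takes the value [q.[x]] at [x]. *)
Lemma mup_simple_root (F : fieldType) (p : {poly F}) x :
  root p x -> ~~ root p^`() x -> mup x p = 1%N.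
Proof.
move=> /factor_theorem[q ->]; rewrite derivM derivXsubC mulr1 rootE !hornerE.
rewrite subrr mulr0 add0r -rootE => qx.
by rewrite mupMr // -['X - _]expr1 mup_XsubCX eqxx.
Qed.

(* Descartes' rule of signs for the sign pattern of [p.[- s]]. *)
Lemma cubic_negative_root (R : rcfType) (a b c : R) :
  let p : {poly R} := 'X^3 - a *: 'X^2 - b *: 'X + c%:P in
  0 <= a -> 0 < b -> 0 < c ->
  exists x, [/\ x < 0, root p x, ~~ root p^`() x
    & forall y, y < 0 -> root p y -> y = x].
Proof.
move=> p a0 b0 c0.
have pE t : p.[t] = t ^+ 3 - a * t ^+ 2 - b * t + c by rewrite !hornerE.
have dE t : p^`().[t] = 3 * t ^+ 2 - 2 * a * t - b.
  by rewrite /p !derivE !hornerE /=; ring.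
(* With [s = 1 + b + c >= 1], [s ^+ 2 - b >= s - b = 1 + c], so [p.[- s] <= c - s * (s ^+ 2 - b) <
   0], while [p.[0] = c > 0]. *)
have [||x /andP[_ x0] px] := @poly_ivt R p (- (1 + b + c)) 0.
- by lra.
- rewrite !pE; apply/andP; split; last first.
    by rewrite !expr0n /= !mulr0 !subr0 add0r ltW.
  set s := 1 + b + c; have s1 : 1 <= s by rewrite /s; lra.
  have s2 : s <= s ^+ 2 by rewrite expr2 ler_peMr // (le_trans ler01).
  have as2 : 0 <= a * s ^+ 2 by rewrite mulr_ge0 // sqr_ge0.
  have : s ^+ 2 - b <= s * (s ^+ 2 - b).
    by rewrite ler_peMl //; move: s2; rewrite /s; lra.
  have -> : (- s) ^+ 3 - a * (- s) ^+ 2 - b * - s + c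
    = c - a * s ^+ 2 - s * (s ^+ 2 - b) by ring.
  by move: s2; rewrite {1}/s; lra.
have {}x0 : x < 0.
  rewrite lt_neqAle x0 andbT; apply: contraTneq px => ->.
  by rewrite rootE pE !expr0n /= !mulr0 !subr0 add0r gt_eqF.
exists x; split=> //.
  rewrite rootE dE; move: px; rewrite rootE pE => /eqP px.
  apply/eqP => dx.
  have : 0 <= a * x ^+ 2 by rewrite mulr_ge0 // sqr_ge0.
  have : x ^+ 3 < 0 by rewrite exprn_odd_lt0.
  have : c + a * x ^+ 2 - 2 * x ^+ 3 = 0.
    transitivity (x ^+ 3 - a * x ^+ 2 - b * x + c
                  - x * (3 * x ^+ 2 - 2 * a * x - b)); first by ring.
    by rewrite px dx mulr0 subr0.
  lra.
move=> y y0; move: px; rewrite !rootE !pE => /eqP px /eqP py.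
have xy : 0 < x * y by rewrite nmulr_rgt0.
have c1 : 0 < c - x * y * (x + y) + a * (x * y).
  have : 0 <= a * (x * y) by apply: mulr_ge0 => //; apply: ltW.
  have : x * y * (x + y) < 0 by rewrite pmulr_rlt0 //; lra.
  lra.
(* The combination [x * p.[y] - y * p.[x]] eliminates [b] and is divisible by [x - y], with a
   positive cofactor. *)
have /eqP : (x - y) * (c - x * y * (x + y) + a * (x * y)) = 0.
  transitivity (x * (y ^+ 3 - a * y ^+ 2 - b * y + c)
                - y * (x ^+ 3 - a * x ^+ 2 - b * x + c)); first by ring.
  by rewrite px py !mulr0 subr0.
by rewrite mulf_eq0 (gt_eqF c1) orbF subr_eq0 => /eqP.
Qed.

Theorem theorem3p6 (R : realType) (A : 'M[R]_3) (hA : E0_2_matrix A) :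
  [/\ \det A < 0,
      A \in unitmx,
      Z_matrix (invmx A)
    & exactly_one_negative_eigenvalue A].
Proof.
case: hA => [sA nA].
have d0 i : 0 <= A i i by apply/semimonotone_principal1/sA; rewrite cards1.
have pair i j : i != j ->
    [/\ A i j < 0, A j i < 0 & A i i * A j j < A i j * A j i].
  move=> ij; apply: not_semimonotone_principal2 => //.
  by apply: nA; left; rewrite cards2 ij.
have [f fA] := mx33_fun _ A.
have fE i j : A i j = f i j by rewrite fA mxE.
have [f01 f10 m01] : [/\ f 0 1 < 0, f 1 0 < 0 & f 0 0 * f 1 1 < f 0 1 * f 1 0].
  by have := pair 0 1 isT; rewrite !fE.
have [f02 f20 m02] : [/\ f 0 2 < 0, f 2 0 < 0 & f 0 0 * f 2 2 < f 0 2 * f 2 0].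
  by have := pair 0 2%:R isT; rewrite !fE.
have [f12 f21 m12] : [/\ f 1 2 < 0, f 2 1 < 0 & f 1 1 * f 2 2 < f 1 2 * f 2 1].
  by have := pair 1 2%:R isT; rewrite !fE.
have f00 : 0 <= f 0 0 by have := d0 0; rewrite fE.
have f11 : 0 <= f 1 1 by have := d0 1; rewrite fE.
have f22 : 0 <= f 2 2 by have := d0 2%:R; rewrite fE.
have detA : \det A < 0.
  rewrite fA det_mx33.
  (* Only nonpositive, since [f 0 0] may vanish; strictness comes from the other two terms. *)
  have : f 0 0 * (f 1 1 * f 2 2 - f 1 2 * f 2 1) <= 0.
    by apply: mulr_ge0_le0 => //; lra.
  have : 0 < f 0 1 * (f 1 0 * f 2 2 - f 1 2 * f 2 0).
    rewrite nmulr_rgt0 // subr_lt0 (@le_lt_trans _ _ 0) //.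
      by rewrite mulr_le0_ge0 // ltW.
    by rewrite nmulr_rgt0.
  have : f 0 2 * (f 1 0 * f 2 1 - f 1 1 * f 2 0) < 0.
    rewrite nmulr_rlt0 // subr_gt0 (@le_lt_trans _ _ 0) //.
      by rewrite mulr_ge0_le0 // ltW.
    by rewrite nmulr_rgt0.
  lra.
have uA : A \in unitmx by rewrite unitmxE unitfE lt_eqF.
split=> //.
  move=> i j ij; rewrite /invmx uA !mxE; apply: mulr_le0_ge0.
    by rewrite invr_le0 ltW.
  rewrite /cofactor det_mx22 !mxE !fE.
  (* In each of the six cases, 0 separates the two products whose difference is the signed
     cofactor. *)
  case: i j ij => [[|[|[|//]]] ?] [[|[|[|//]]] ?] // _;
    rewrite /= /bump /= ?modn_small // ?addn0 ?add0n ?addn1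
      ?(exprS, expr0, mulr1, mulN1r, mul1r, opprK, opprB) subr_ge0;
    apply: (@le_trans _ _ 0);
    by [rewrite mulr_le0 // ltW | rewrite mulr_ge0_le0 // ltW
       | rewrite mulr_le0_ge0 // ltW].
(* The second coefficient is minus the sum of the principal minors of order 2, hence positive. *)
have [||| x [x0 px dpx x_uniq]] := cubic_negative_root _ (f 0 0 + f 1 1 + f 2 2)
    (f 0 1 * f 1 0 - f 0 0 * f 1 1 + (f 0 2 * f 2 0 - f 0 0 * f 2 2)
       + (f 1 2 * f 2 1 - f 1 1 * f 2 2)) (- \det A).
- by rewrite !addr_ge0.
- lra.
- by rewrite oppr_gt0.
move: px dpx x_uniq; rewrite fA -char_poly_mx33 -fA => px dpx x_uniq.
exists x; split=> //.
- by rewrite eigenvalue_root_char.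
- exact: mup_simple_root.
- by move=> y y0; rewrite eigenvalue_root_char; apply: x_uniq.
Qed.
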